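(* Let $f\colon\mathbb{N}\to\mathbb{N}$ be a monotonically increasing invertible function and let $\mathcal{G}$ be an $f$-independence friendly class. Then there is an algorithm that solves $\mathcal{G}$-Sb-MWIS in time $O\big((f^{-1}(k))^k\cdot(n+m)^{O(1)}\big)$, where $n$ and $m$ are the numbers of vertices and edges of the input graph.
   Context: A graph class $\mathcal{G}$ is an $f$-independence friendly class ($f$-ifc) if $\mathcal{G}$ is hereditary (closed under induced subgraphs) and every graph $G\in\mathcal{G}$ on $n$ vertices has an independent set of size $f(n)$. Sb-MWIS: the input is a graph $G$, positive integers $k$ and $\rho$, and a weight function $w\colon V(G)\to\mathbb{N}$; the question is whether there is an independent set $S$ of $G$ with $|S|\le k$ and $\sum_{v\in S}w(v)\ge\rho$. $\mathcal{G}$-Sb-MWIS is its restriction to input graphs $G\in\mathcal{G}$. *)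

(* Defs.v *)
From mathcomp Require Import all_boot.

Set Implicit Arguments.
Unset Strict Implicit.
Unset Printing Implicit Defensive.

Record sgraph := SGraph {
  vertex :> finType;
  adj : rel vertex;
  adj_sym : symmetric adj;
  adj_irr : irreflexive adj }.

Definition edges (G : sgraph) : {set {set G}} :=
  [set [set p.1; p.2] | p : G * G & adj p.1 p.2].

Definition independent (G : sgraph) (S : {set G}) : bool :=
  [forall x in S, forall y in S, ~~ adj x y].

Section Induced.
Variables (G : sgraph) (A : {set G}).

Definition induced_adj : rel {x : G | x \in A} := relpre val (@adj G).

Fact induced_sym : symmetric induced_adj.
Proof. by move=> x y; apply: adj_sym. Qed.

Fact induced_irr : irreflexive induced_adj.
Proof. by move=> x; apply: adj_irr. Qed.

Definition induced : sgraph := SGraph induced_sym induced_irr.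

End Induced.

Definition hereditary (C : sgraph -> Prop) : Prop :=
  forall (G : sgraph) (A : {set G}), C G -> C (induced A).

Definition ifc (f : nat -> nat) (C : sgraph -> Prop) : Prop :=
  hereditary C /\
  forall G : sgraph, C G ->
    exists S : {set G}, independent S /\ #|S| = f #|G|.

(* A bijective monotone map on nat is the identity, so "invertible" is read as
   "unbounded", and the inverse as the generalized one, min {n | k <= f n};
   geninvK shows that it inverts f whenever f is injective. *)
Definition geninv (f : nat -> nat) (f_unb : forall k, exists n, k <= f n)
  (k : nat) : nat := ex_minn (f_unb k).

Lemma geninvK (f : nat -> nat) (f_unb : forall k, exists n, k <= f n) :
  {homo f : x y / x <= y} -> injective f -> cancel f (geninv f_unb).
Proof.
move=> f_mono f_inj n; rewrite /geninv; case: ex_minnP => m fn_le m_min.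
apply: f_inj; apply/eqP; rewrite eqn_leq fn_le andbT.
by apply: f_mono; apply: m_min.
Qed.

Definition sbmwis (G : sgraph) (k rho : nat) (w : G -> nat) : bool :=
  [exists S : {set G},
     [&& independent S, #|S| <= k & rho <= \sum_(v in S) w v]].

(* The model of computation is the unit-cost RAM: finitely many of the
   registers reg 0, reg 1, ... occur in a given program, and the unbounded
   memory is reached only by indirect addressing.  Cells hold natural
   numbers.  Since the time bound does not depend on the bit lengths of the
   weights and of rho, operations on numbers must have unit cost; the only
   arithmetic is addition and truncated subtraction, so that each instruction
   increases the bit length of the largest number stored by at most one (or to
   that of a constant of the program). *)
Inductive instr :=
  | Const (r c : nat)
  | Add (r s t : nat)
  | Sub (r s t : nat)
  | Read (r s : nat)
  | Write (r s : nat)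
  | Jz (r l : nat).

Definition program := seq instr.

Record config := Config { pc : nat; reg : nat -> nat; memory : nat -> nat }.

Definition upd (h : nat -> nat) (a v : nat) : nat -> nat :=
  fun b => if b == a then v else h b.

Definition exec (i : instr) (c : config) : config :=
  let: Config p R M := c in
  match i with
  | Const r v => Config p.+1 (upd R r v) M
  | Add r s t => Config p.+1 (upd R r (R s + R t)) M
  | Sub r s t => Config p.+1 (upd R r (R s - R t)) M
  | Read r s => Config p.+1 (upd R r (M (R s))) M
  | Write r s => Config p.+1 R (upd M (R r) (R s))
  | Jz r l => Config (if R r == 0 then l else p.+1) R M
  end.

(* A configuration whose pc lies outside the program has halted; it is left
   unchanged by step. *)
Definition step (P : program) (c : config) : config :=
  if onth P (pc c) is Some i then exec i c else c.

Definition init (x : seq nat) : config :=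
  Config 0 (fun _ => 0) (fun a => nth 0 x a).

(* On input x, P halts after at most t instructions with b in register 0. *)
Definition outputs (P : program) (x : seq nat) (t b : nat) : Prop :=
  let c := iter t (step P) (init x) in size P <= pc c /\ reg c 0 = b.

(* The input word lists n, m, k, rho, the weights of the vertices and the edges
   as pairs of vertex numbers.  The order vs of the vertices, the order of the
   edges and the orientation of each edge are arbitrary. *)
Definition encodes (G : sgraph) (k rho : nat) (w : G -> nat) (x : seq nat) :
    Prop :=
  exists (vs : seq G) (es : seq (G * G)),
    [/\ perm_eq vs (enum G),
        perm_eq [seq [set e.1; e.2] | e <- es] (enum (edges G)) &
        x = [:: #|G|; #|edges G|; k; rho] ++ [seq w v | v <- vs]
            ++ flatten [seq [:: index e.1 vs; index e.2 vs] | e <- es]].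

(* Main.v *)
Require Import Defs.
From mathcomp Require Import all_boot.
From mathcomp Require Import zify.
(* [Sub] would otherwise be [eqtype.Sub]. *)
Import Defs.

Set Implicit Arguments.
Unset Strict Implicit.
Unset Printing Implicit Defensive.

(* The program cannot evaluate [f], which need not be computable, so the cut-off
   f^-1(k) is not computed but discovered.  Sort the vertices by decreasing weight
   and enumerate the independent sets of size at most k as increasing sequences,
   depth first.  A node of the search tree chooses the next vertex from a residual
   graph with a remaining budget j; as soon as some prefix of the residual graph is
   seen to contain an independent j-set I, no choice beyond this prefix has to be
   tried, because a set of at most j later vertices is no heavier than I.  The least
   such prefix is found by the recursion itself: it ends at the least last element
   of the j-sets enumerated so far.  Any h = f^-1(k) vertices of the residual graph
   contain an independent j-set, because the class is hereditary, so every node has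
   at most h children. *)

(** * A structured language on top of the RAM *)

Definition state := ((nat -> nat) * (nat -> nat))%type.

(** The program counter 0 is a dummy: [eff] is used for instructions that are not jumps, whose
    effect does not depend on it. *)
Definition eff (s : state) (i : instr) : state :=
  let c := exec i (Config 0 s.1 s.2) in (reg c, memory c).

Inductive com :=
  | Blk of seq instr
  | Seq of com & com
  | Ifz of nat & com & com
  | While of nat & com.

Local Notation "a ;; b" := (Seq a b) (at level 80, right associativity).

Local Notation rRes := 0.
(* Holds 0 throughout, so that [Jz rZ l] is an unconditional jump. *)
Local Notation rZ := 1.

(** Jump targets are absolute, so [o] is the address at which the code will be placed. The nonzero
    branch of [Ifz] comes first and jumps over the other one. *)
Fixpoint code (o : nat) (c : com) : program :=
  match c with
  | Blk l => l
  | Seq a b => let p := code o a in p ++ code (o + size p) b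
  | Ifz r a b =>
    let q := code o.+1 b in
    let o1 := (o + size q).+2 in
    let p := code o1 a in
    Jz r o1 :: q ++ Jz rZ (o1 + size p) :: p
  | While r a =>
    let p := code o.+1 a in
    Jz r (o + size p).+2 :: p ++ [:: Jz rZ o]
  end.

Definition dest (i : instr) : option nat :=
  match i with
  | Const r _ | Add r _ _ | Sub r _ _ | Read r _ => Some r
  | Write _ _ | Jz _ _ => None
  end.

Definition is_write (i : instr) := if i is Write _ _ then true else false.
Definition is_jump (i : instr) := if i is Jz _ _ then true else false.

Fixpoint instrs (c : com) : seq instr :=
  match c with
  | Blk l => l
  | Seq a b | Ifz _ a b => instrs a ++ instrs b
  | While _ a => instrs a
  end.

(** A syntactic check, so that frame conditions on concrete commands hold by computation. *)
Definition keeps (r : nat) (c : com) := all (fun i => dest i != Some r) (instrs c).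

(** The number is the exact count of RAM instructions, compiled jumps included: a round of a loop
    pays 2 for its test and its backward jump, a nonzero branch 2 for the test and the jump over the
    other branch. *)
Inductive run : com -> state -> nat -> state -> Prop :=
  | RunBlk l s : run (Blk l) s (size l) (foldl eff s l)
  | RunSeq a b s s1 s2 t1 t2 :
      run a s t1 s1 -> run b s1 t2 s2 -> run (Seq a b) s (t1 + t2) s2
  | RunIfZ r a b s s1 t :
      s.1 r = 0 -> run a s t s1 -> run (Ifz r a b) s t.+1 s1
  | RunIfN r a b s s1 t :
      s.1 r != 0 -> run b s t s1 -> run (Ifz r a b) s t.+2 s1
  | RunWhileZ r a s : s.1 r = 0 -> run (While r a) s 1 s
  | RunWhileN r a s s1 s2 t1 t2 :
      s.1 r != 0 -> run a s t1 s1 -> run (While r a) s1 t2 s2 ->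
      run (While r a) s (t1 + t2).+2 s2.

Lemma eff_reg (s : state) i r : dest i != Some r -> (eff s i).1 r = s.1 r.
Proof.
by case: i => //= a; rewrite /upd; case: (eqVneq r a) => // -> *; exfalso;
  move: (eqxx (Some a)); exact/negP.
Qed.

Lemma eff_mem (s : state) i : ~~ is_write i -> (eff s i).2 = s.2.
Proof. by case: i. Qed.

Lemma run_reg c s t s' r : run c s t s' -> keeps r c -> s'.1 r = s.1 r.
Proof.
rewrite /keeps; elim=> {c s t s'} //=.
- by elim=> //= i l IH s /andP[ir lr]; rewrite IH // eff_reg.
- by move=> a b s s1 s2 t1 t2 _ IH1 _ IH2; rewrite all_cat => /andP[/IH1 <- /IH2].
- by move=> r' a b s s1 t _ _ IH; rewrite all_cat => /andP[/IH].
- by move=> r' a b s s1 t _ _ IH; rewrite all_cat => /andP[_ /IH].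
- by move=> r' a s s1 s2 t1 t2 _ _ IH1 _ IH2 ar; rewrite IH2 ?IH1.
Qed.

Lemma run_mem c s t s' :
  run c s t s' -> ~~ has is_write (instrs c) -> s'.2 = s.2.
Proof.
elim=> {c s t s'} //=.
- by elim=> //= i l IH s; rewrite negb_or => /andP[ir lr]; rewrite IH // eff_mem.
- by move=> a b s s1 s2 t1 t2 _ IH1 _ IH2; rewrite has_cat negb_or => /andP[/IH1 <- /IH2].
- by move=> r' a b s s1 t _ _ IH; rewrite has_cat negb_or => /andP[/IH].
- by move=> r' a b s s1 t _ _ IH; rewrite has_cat negb_or => /andP[_ /IH].
- by move=> r' a s s1 s2 t1 t2 _ _ IH1 _ IH2 ar; rewrite IH2 ?IH1.
Qed.

Definition at_pc (p : nat) (s : state) : config := Config p s.1 s.2.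

Lemma step_at P pre i post s : P = pre ++ i :: post ->
  step P (at_pc (size pre) s) = exec i (at_pc (size pre) s).
Proof.
move=> ->; rewrite /step /=.
by rewrite onth_cat ltnn subnn.
Qed.

Lemma exec_eff i p s : ~~ is_jump i -> exec i (at_pc p s) = at_pc p.+1 (eff s i).
Proof. by case: i. Qed.

(** The surrounding [pre] and [post] make the induction go through subcommands, which sit at
    arbitrary addresses of the program. Since [rZ] starts at 0 and is never written, the jumps on it
    are always taken. *)
Lemma run_code c s t s' : run c s t s' -> keeps rZ c ->
  ~~ has is_jump (instrs c) -> s.1 rZ = 0 ->
  forall P pre post, P = pre ++ code (size pre) c ++ post ->
  iter t (step P) (at_pc (size pre) s) =
    at_pc (size pre + size (code (size pre) c)) s'.
Proof.
elim=> {c s t s'} /=.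
- rewrite /keeps /=; elim=> [|i l IH] s /=; first by move=> _ _ _ P pre post _;
    rewrite addn0.
  move=> /andP[iZ lZ]; rewrite negb_or => /andP[ij lj] sZ P pre post ->.
  rewrite -iterS iterSr (step_at _ (erefl _)) exec_eff //.
  have -> : (size pre).+1 = size (rcons pre i) by rewrite size_rcons.
  rewrite (IH _ _ _ _ _ (rcons pre i) post) //; last by rewrite cat_rcons.
    by rewrite size_rcons addSnnS.
  by rewrite eff_reg.
- move=> a b s s1 s2 t1 t2 ra IHa rb IHb; rewrite /keeps /= all_cat has_cat negb_or.
  move=> /andP[aZ bZ] /andP[aj bj] sZ P pre post ->.
  rewrite addnC iterD (IHa aZ aj sZ _ _ (code (size pre + size (code (size pre) a)) b ++ post)) ?catA //.
  rewrite -size_cat (IHb bZ bj _ _ _ post) -?catA ?size_cat ?addnA //.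
  by rewrite (run_reg ra).
- move=> r a b s s1 t sr ra IH; rewrite /keeps /= all_cat has_cat negb_or.
  move=> /andP[aZ bZ] /andP[aj bj] sZ P pre post EP.
  rewrite -iterS iterSr (step_at _ EP) /= sr /= -/(at_pc _ _).
  move: EP; set q := code _ b; set o1 := (_ + size q).+2; set J := Jz rZ _;
    set J' := Jz r _.
  move=> EP; have o1E : o1 = size (pre ++ J' :: q ++ [:: J]).
    by rewrite size_cat /= size_cat /=; lia.
  rewrite o1E (IH aZ aj sZ _ _ post); last by rewrite -o1E EP -?catA /= -?catA /=.
  by rewrite -o1E; congr at_pc; rewrite size_cat /= /o1; lia.
- move=> r a b s s1 t sr ra IH; rewrite /keeps /= all_cat has_cat negb_or.
  move=> /andP[aZ bZ] /andP[aj bj] sZ P pre post EP.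
  rewrite -iterS iterSr (step_at _ EP) /= (negPf sr) /= -/(at_pc _ _).
  move: EP; set q := code _ b; set o1 := (_ + size q).+2; set J := Jz rZ _;
    set J' := Jz r _.
  move=> EP; have pE : (size pre).+1 = size (rcons pre J') by rewrite size_rcons.
  rewrite -iterS iterS pE.
  rewrite (IH bZ bj sZ P _ (J :: code o1 a ++ post)); last first.
    by rewrite -pE EP -!cats1 -?catA /= -?catA.
  have -> : size (rcons pre J') + size (code (size (rcons pre J')) b) = size (pre ++ J' :: q).
    by rewrite size_cat -pE /= -/q; lia.
  rewrite (step_at (i := J) (post := code o1 a ++ post)); last first.
    by rewrite EP -?catA /= -?catA.
  rewrite /= (run_reg ra) // sZ /=; congr at_pc.
  by rewrite size_cat /= /o1; lia.
- move=> r a s sr _ _ _ P pre post EP.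
  rewrite (step_at _ EP) /= sr /= /at_pc; congr Config.
  by rewrite size_cat /=; lia.
- move=> r a s s1 s2 t1 t2 sr ra IHa rw IHw; rewrite /keeps /=.
  move=> aZ aj sZ P pre post EP.
  rewrite -[step P (step P _)]/(iter 2 _ _) -iterD.
  (* In order of execution, from right to left: the test, the body, the jump back, the remaining
     rounds. *)
  have -> : 2 + (t1 + t2) = t2 + 1 + t1 + 1 by lia.
  rewrite 3!iterD [iter 1 _ (at_pc _ _)]/=.
  rewrite (step_at _ EP) /= (negPf sr) /= -/(at_pc _ _).
  move: (EP); set p := code _ a; set J' := Jz r _ => EP'.
  have pE : (size pre).+1 = size (rcons pre J') by rewrite size_rcons.
  rewrite pE (IHa aZ aj sZ P _ (Jz rZ (size pre) :: post)); last first.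
    by rewrite -pE EP' -!cats1 -?catA /= -?catA.
  have -> : size (rcons pre J') + size (code (size (rcons pre J')) a) = size (pre ++ J' :: p).
    by rewrite size_cat -pE /= -/p; lia.
  rewrite (step_at (i := Jz rZ (size pre)) (post := post)); last first.
    by rewrite EP' -?catA /= -?catA.
  have s1Z : s1.1 rZ = 0 by rewrite (run_reg ra).
  by rewrite /= s1Z /= (IHw aZ aj s1Z P pre post EP).
Qed.

(** * Total correctness with a time bound *)

Definition runs (c : com) (s : state) (T : nat) (Q : state -> Prop) : Prop :=
  exists t s', [/\ t <= T, run c s t s' & Q s'].

Lemma runs_blk l s T (Q : state -> Prop) :
  size l <= T -> Q (foldl eff s l) -> runs (Blk l) s T Q.
Proof. by move=> lT Qs; exists (size l), (foldl eff s l); split=> //; constructor. Qed.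

Lemma runs_seq T1 T2 a b s (Q : state -> Prop) :
  runs a s T1 (fun s1 => runs b s1 T2 Q) -> runs (a ;; b) s (T1 + T2) Q.
Proof.
move=> [t1 [s1 [t1T ra [t2 [s2 [t2T rb Qs2]]]]]].
by exists (t1 + t2), s2; split=> //; [exact: leq_add | econstructor; eauto].
Qed.

Lemma runs_if T r a b s (Q : state -> Prop) :
  (if s.1 r == 0 then runs a s T Q else runs b s T Q) ->
  runs (Ifz r a b) s T.+2 Q.
Proof.
case: eqP => [r0 | /eqP r0] [t [s1 [tT rc Qs1]]].
  by exists t.+1, s1; split=> //; [lia | constructor].
by exists t.+2, s1; split=> //; constructor.
Qed.

Lemma runs_weak T T' c s (Q Q' : state -> Prop) :
  runs c s T Q -> T <= T' -> (forall s', Q s' -> Q' s') -> runs c s T' Q'.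
Proof.
move=> [t [s' [tT rc Qs]]] TT QQ.
by exists t, s'; split=> //; [exact: leq_trans TT | exact: QQ].
Qed.

(** The invariant is indexed by the rounds done and must determine the loop test, which forces
    exactly [n] rounds; the final successor pays for the failing test. *)
Lemma runs_while n T (Inv : nat -> state -> Prop) r c s :
  Inv 0 s ->
  (forall i s, i <= n -> Inv i s -> (s.1 r != 0) = (i < n)) ->
  (forall i s, i < n -> Inv i s -> runs c s T (Inv i.+1)) ->
  runs (While r c) s (n * T.+2).+1 (Inv n).
Proof.
move=> I0 cond body.
suff main d i s1 : i + d = n -> Inv i s1 -> runs (While r c) s1 (d * T.+2).+1 (Inv n).
  by apply: main I0.
elim: d i s1 => [|d IH] i s1 idn Ii; have := cond i s1.
  rewrite addn0 in idn; rewrite -idn in Ii *;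
    rewrite leqnn ltnn => /(_ isT Ii)/negbFE/eqP r0.
  by exists 1, s1; split=> //; apply: RunWhileZ.
have lt_in : i < n by lia.
rewrite lt_in => /(_ (ltnW lt_in) Ii) r0.
have [t1 [s2 [t1T rc Ii1]]] := body _ _ lt_in Ii.
have [|t2 [s3 [t2T rw In]]] := IH i.+1 s2 _ Ii1; first by lia.
by exists (t1 + t2).+2, s3; split=> //; [nia | econstructor; eauto].
Qed.

Lemma runs_frame c s T (Q : state -> Prop) :
  runs c s T Q ->
  runs c s T (fun s' => [/\ Q s', (forall r, keeps r c -> s'.1 r = s.1 r)
                & ~~ has is_write (instrs c) -> s'.2 = s.2]).
Proof.
move=> [t [s' [tT rc Qs]]]; exists t, s'; split=> //; split=> // [r|].
  exact: run_reg rc.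
exact: run_mem rc.
Qed.

(** * Symbolic execution of loop-free commands *)

Fixpoint loop_free (c : com) : bool :=
  match c with
  | Blk _ => true
  | Seq a b | Ifz _ a b => loop_free a && loop_free b
  | While _ _ => false
  end.

Fixpoint cost (c : com) : nat :=
  match c with
  | Blk l => size l
  | Seq a b => cost a + cost b
  | Ifz _ a b => (maxn (cost a) (cost b)).+2
  | While _ _ => 0
  end.

Fixpoint den (c : com) (s : state) : state :=
  match c with
  | Blk l => foldl eff s l
  | Seq a b => den b (den a s)
  | Ifz r a b => if s.1 r == 0 then den a s else den b s
  | While _ _ => s
  end.

Lemma runs_den c s T (Q : state -> Prop) :
  loop_free c -> cost c <= T -> Q (den c s) -> runs c s T Q.
Proof.
move=> lf cT Qs; suff : runs c s (cost c) (eq (den c s)).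
  by move/runs_weak; apply=> // s' <-.
elim: c s lf {T cT Q Qs} => //= [l|a IHa b IHb|r a IHa b IHb] s.
- by move=> _; apply: runs_blk.
- move=> /andP[lfa lfb]; apply: runs_seq; apply: runs_weak (IHa s lfa) _ _ => // s' <-.
  exact: IHb.
- move=> /andP[lfa lfb]; apply: runs_if; case: (s.1 r == 0).
    exact: runs_weak (IHa s lfa) (leq_maxl _ _) (fun _ E => E).
  exact: runs_weak (IHb s lfb) (leq_maxr _ _) (fun _ E => E).
Qed.

(** * The search as an abstract machine *)

Lemma independentP (G : sgraph) (S : {set G}) :
  reflect (forall x y, x \in S -> y \in S -> ~~ adj x y) (independent S).
Proof.
apply: (iffP forall_inP) => [indS x y xS yS | indS x xS].
  by have /forall_inP := indS x xS; apply.
by apply/forall_inP => y yS; apply: indS.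
Qed.

Lemma independentS (G : sgraph) (A B : {set G}) :
  A \subset B -> independent B -> independent A.
Proof.
move=> /subsetP AB /independentP indB; apply/independentP => x y xA yA.
by apply: indB; apply: AB.
Qed.

Lemma independentU1 (G : sgraph) (v : G) (A : {set G}) :
  independent A -> (forall x, x \in A -> ~~ adj x v) -> independent (v |: A).
Proof.
move=> /independentP indA Av; apply/independentP => x y.
rewrite !inE => /predU1P[-> | xA] /predU1P[-> | yA]; rewrite ?adj_irr //.
- by rewrite adj_sym Av.
- exact: Av.
- exact: indA.
Qed.

(** The maximum weight in [Y] separates the two sums: it bounds every weight in [Y] from above and
    every weight in [I] from below. *)
Lemma leq_sum_dominated (T : finType) (w : T -> nat) (Y I : {set T}) :
  #|Y| <= #|I| -> (forall x y, x \in I -> y \in Y -> w y <= w x) ->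
  \sum_(y in Y) w y <= \sum_(x in I) w x.
Proof.
move=> YI le_w; set m := \max_(y in Y) w y.
apply: (@leq_trans (#|Y| * m)).
  by rewrite -sum_nat_const; apply: leq_sum => y yY; apply: leq_bigmax_cond.
apply: (@leq_trans (#|I| * m)); first by rewrite leq_mul2r YI orbT.
rewrite -sum_nat_const; apply: leq_sum => x xI.
by apply/bigmax_leqP => y yY; apply: le_w.
Qed.

Lemma pick_inj (T : finType) (g : T -> nat) v :
  injective g -> [pick u | g u == g v] = Some v.
Proof.
move=> g_inj; case: pickP => [u /eqP/g_inj -> //|/(_ v)].
by rewrite eqxx.
Qed.

Section Search.

Variables (G : sgraph) (w pos : G -> nat) (k rho h : nat).
Local Notation n := #|G|.

(* A frame holds a chosen vertex and the bound of the node that chose it. *)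
Record astate := AState {
  frames : seq (G * nat); cand : nat; bound : nat; answer : option bool }.

Definition free (s : seq (G * nat)) (v : G) := all (fun p => ~~ adj v p.1) s.
Definition total (s : seq (G * nat)) := \sum_(p <- s) w p.1.

(** Position [c] is tried next, and [b] is the bound of the current node so far. A child without
    budget starts with its bound at its candidate, because the empty set is its independent 0-set,
    and so is left at once. A child's bound below [n] is also the end of an independent set through
    [v], hence the minimum on return. *)
Definition astep (a : astate) : astate :=
  let: AState s c b r := a in
  if r is Some _ then a else
  if c < b then
    if [pick v | pos v == c] is Some v then
      if free s v then
        AState ((v, b) :: s) c.+1 (if (size s).+1 == k then c.+1 else n)
          (if rho <= total ((v, b) :: s) then Some true else None)
      else AState s c.+1 b None
    else a
  else if s is (v, b') :: s' then AState s' (pos v).+1 (minn b b') None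
  else AState s c b (Some false).

Fixpoint wf_frames (c : nat) (s : seq (G * nat)) : bool :=
  if s is (v, b) :: s' then
    [&& pos v < c, b <= n, free s' v & wf_frames (pos v) s']
  else true.

Definition residual (s : seq (G * nat)) (c : nat) : {set G} :=
  [set v | (c <= pos v) && free s v].

Hypothesis pos_lt : forall v, pos v < n.
Hypothesis pos_inj : injective pos.
Hypothesis pos_onto : forall c, c < n -> exists v, pos v = c.
Hypothesis pos_w : forall u v, pos u <= pos v -> w v <= w u.
Hypothesis h_indep : forall (A : {set G}) j, h <= #|A| -> j <= k ->
  exists I : {set G}, [/\ I \subset A, independent I & #|I| = j].
Hypothesis rho_gt0 : 0 < rho.

Lemma wf_frames_lt c s v : wf_frames c s -> v \in map fst s -> pos v < c.
Proof.
elim: s c => //= -[u b] s IH c /= /and4P[uc _ _ us].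
rewrite inE => /predU1P[-> // | vs]; exact: ltn_trans (IH _ us vs) uc.
Qed.

Lemma wf_frames_le c c' s : c <= c' -> wf_frames c s -> wf_frames c' s.
Proof.
case: s => //= -[u b] s cc' /= /and4P[uc -> -> ->].
by rewrite (leq_trans uc cc').
Qed.

Lemma wf_frames_uniq c s : wf_frames c s -> uniq (map fst s).
Proof.
elim: s c => //= -[u b] s IH c /= /and4P[_ _ _ us].
rewrite (IH _ us) andbT; apply/negP => /(wf_frames_lt us).
by rewrite ltnn.
Qed.

Lemma wf_frames_indep c s :
  wf_frames c s -> independent [set v in map fst s].
Proof.
elim: s c => [|[u b] s IH] c /=; first by move=> _; apply/independentP => x y;
  rewrite inE.
move=> /and4P[_ _ /allP us ok]; rewrite set_cons; apply: independentU1;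
  first exact: IH ok.
by move=> x; rewrite inE adj_sym => /mapP[p ps ->]; apply: us.
Qed.

Lemma wf_frames_sbmwis c s :
  wf_frames c s -> size s <= k -> rho <= total s -> sbmwis k rho w.
Proof.
move=> ok sk tot; apply/existsP; exists [set v in map fst s].
rewrite (wf_frames_indep ok) cardsE (card_uniqP (wf_frames_uniq ok)) size_map sk /=.
rewrite (eq_bigl (mem (map fst s))) => [|v]; last by rewrite inE.
by rewrite -big_uniq ?(wf_frames_uniq ok) //= big_map.
Qed.

(** * What is known at a node of the search tree *)

Definition hopeless j s c0 : Prop := forall Y : {set G}, independent Y ->
  Y \subset residual s c0 -> #|Y| <= j -> total s + \sum_(v in Y) w v < rho.

(* [b] is the least bound such that the residual vertices before it contain an
   independent set of size [j], or [n] if there is none. *)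
Definition prefix_bound j s c0 b : Prop :=
  [/\ c0 <= b, b <= n,
   b < n -> exists I : {set G}, [/\ independent I, I \subset residual s c0,
     #|I| = j & forall x, x \in I -> pos x < b] &
   forall d (I : {set G}), independent I -> I \subset residual s c0 ->
     #|I| = j -> c0 <= d -> (forall x, x \in I -> pos x < d) -> b <= d].

(** This is [hopeless] and [prefix_bound] for a node in progress: the universal claims cover only
    sets with a vertex before [c], that is, sets whose first vertex has been tried. *)
Definition search_inv j s c0 c b : Prop :=
  [/\ c0 <= b <= n,
   forall Y : {set G}, independent Y -> Y \subset residual s c0 -> #|Y| <= j ->
     (exists2 y, y \in Y & pos y < c) -> total s + \sum_(v in Y) w v < rho,
   b < n -> exists I : {set G}, [/\ independent I, I \subset residual s c0,
     #|I| = j & forall x, x \in I -> pos x < b] &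
   forall d (I : {set G}), independent I -> I \subset residual s c0 ->
     #|I| = j -> c0 <= d -> (forall x, x \in I -> pos x < d) ->
     (exists2 y, y \in I & pos y < c) -> b <= d].

Lemma search_inv_start j s c0 : c0 <= n -> search_inv j s c0 c0 n.
Proof.
move=> c0n; have none (Y : {set G}) : Y \subset residual s c0 ->
    ~ exists2 y, y \in Y & pos y < c0.
  by move=> /subsetP sub [y /sub]; rewrite inE => /andP[+ _]; rewrite ltnNge => ->.
split; rewrite ?leqnn ?c0n ?ltnn //.
- by move=> Y _ sub _ /(none _ sub).
- by move=> d I _ sub _ _ _ /(none _ sub).
Qed.

Lemma search_inv_skip j s c0 c b v : pos v = c -> ~~ free s v ->
  search_inv j s c0 c b -> search_inv j s c0 c.+1 b.
Proof.
move=> vc nfree [c0b invY invI invd].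
have back (Y : {set G}) : Y \subset residual s c0 ->
    (exists2 y, y \in Y & pos y < c.+1) -> exists2 y, y \in Y & pos y < c.
  move=> /subsetP sub [y yY yc]; exists y => //.
  rewrite ltn_neqAle -ltnS yc andbT -vc; apply: contra nfree => /eqP/pos_inj <-.
  by have := sub y yY; rewrite inE => /andP[].
split=> // [Y indY sub Yj /(back _ sub)|d I indI sub Ij c0d Id /(back _ sub)].
  exact: invY.
exact: invd.
Qed.

(** A nonempty set without a vertex before [c] forces [b < n], and it lies behind the independent
    set that witnesses [b], so it is no heavier. The witness ends before [c], so its first vertex
    was tried and its weight is known to be insufficient. *)
Lemma search_inv_done j s c0 c b : b <= c -> total s < rho ->
  search_inv j.+1 s c0 c b -> hopeless j.+1 s c0 /\ prefix_bound j.+1 s c0 b.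
Proof.
move=> bc tot [/andP[c0b bn] invY invI invd].
split; last first.
  split=> // d I indI sub Ij c0d Id.
  case: (pickP [pred y | (y \in I) && (pos y < c)]) => [y /andP[yI yc]|no].
    by apply: invd Id _ => //; exists y.
  have [y yI] : exists y, y \in I by apply/set0Pn; rewrite -card_gt0 Ij.
  have := no y; rewrite /= yI /= => /negbT; rewrite -leqNgt => cy.
  by apply: leq_trans bc (leq_trans cy _); apply: ltnW; apply: Id.
move=> Y indY sub Yj.
case: (pickP [pred y | (y \in Y) && (pos y < c)]) => [y /andP[yY yc]|no].
  by apply: invY => //; exists y.
have geY y : y \in Y -> c <= pos y.
  by move=> yY; have := no y; rewrite /= yY /= => /negbT; rewrite -leqNgt.
have [->|[y0 y0Y]] := set_0Vmem Y; first by rewrite big_set0 addn0.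
have [|I [indI subI Ij Ib]] := invI.
  exact: leq_ltn_trans bc (leq_ltn_trans (geY _ y0Y) (pos_lt _)).
have [x xI] : exists x, x \in I by apply/set0Pn; rewrite -card_gt0 Ij.
apply: leq_ltn_trans (invY I indI subI _ _); rewrite ?Ij //; last first.
  by exists x => //; apply: leq_trans (Ib _ xI) bc.
rewrite leq_add2l; apply: leq_sum_dominated; rewrite ?Ij // => u v uI vY.
by apply/pos_w/ltnW/(leq_trans (Ib _ uI))/(leq_trans bc)/geY.
Qed.

(** Moving the candidate past [v] brings in only sets whose first vertex is [v]. Without [v], such a
    set lives in the residual graph of the child, by independence. *)
Lemma residual_remove s c0 c b v (Y : {set G}) : pos v = c -> independent Y ->
  Y \subset residual s c0 -> (exists2 y, y \in Y & pos y < c.+1) ->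
  (exists2 y, y \in Y & pos y < c) \/
  (v \in Y /\ Y :\ v \subset residual ((v, b) :: s) c.+1).
Proof.
move=> vc /independentP indY /subsetP sub [y yY yc].
case: (pickP [pred y | (y \in Y) && (pos y < c)]) => [z /andP[zY zc]|no].
  by left; exists z.
right; have geY z : z \in Y -> c <= pos z.
  by move=> zY; have := no z; rewrite /= zY /= => /negbT; rewrite -leqNgt.
have yv : y = v by apply: pos_inj; apply/eqP; rewrite eqn_leq vc geY // -ltnS yc.
rewrite yv in yY; split=> //; apply/subsetP => x; rewrite !inE => /andP[xv xY].
have := sub x xY; rewrite inE => /andP[_ fx]; rewrite /= fx indY // !andbT.
rewrite ltn_neqAle geY // andbT; apply: contra xv => /eqP cx.
by apply/eqP; apply: pos_inj; rewrite vc.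
Qed.

(** Adding [v] turns the sets of the child into the sets of the parent with first vertex [v],
    without changing where they end: [c.+1 <= b1] leaves room for [v] itself, even if the child's
    set is empty. *)
Lemma search_inv_child j s c0 c b b1 v :
  pos v = c -> free s v -> c0 <= c ->
  hopeless j ((v, b) :: s) c.+1 -> prefix_bound j ((v, b) :: s) c.+1 b1 ->
  search_inv j.+1 s c0 c b -> search_inv j.+1 s c0 c.+1 (minn b1 b).
Proof.
move=> vc vfree c0c hop [cb1 b1n exI minI] [/andP[c0b bn] invY invI invd]; split.
- by rewrite leq_min c0b (leq_trans c0c (ltnW cb1)) geq_min bn orbT.
- move=> Y indY sub Yj /(residual_remove b vc indY sub)[lt|[vY sub']]; first exact: invY.
  rewrite (big_setD1 v) //= addnA [total s + _]addnC.
  have := hop (Y :\ v); rewrite /total big_cons; apply=> //.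
    exact: independentS (subD1set _ _) indY.
  by move: Yj; rewrite (cardsD1 v) vY.
- rewrite gtn_min; case: (leqP b b1) => [le | lt] lt_n.
    have bn' : b < n by case/orP: lt_n => // /(leq_ltn_trans le).
    exact: invI.
  have b1n' : b1 < n by case/orP: lt_n => // /(ltn_trans lt).
  have [I [indI /subsetP sub Ij Ib]] := exI b1n'.
  have resI x : x \in I -> [/\ c < pos x, ~~ adj x v & free s x].
    by move/sub; rewrite !inE => /and3P[].
  exists (v |: I); split.
  + by apply: independentU1 => // x /resI[].
  + apply/subsetP => x; rewrite !inE => /predU1P[-> | /resI[cx _ ->]].
      by rewrite vc c0c.
    by rewrite (leq_trans c0c (ltnW cx)).
  + rewrite cardsU1 Ij; case: (boolP (v \in I)) => // /resI[].
    by rewrite vc ltnn.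
  + by move=> x; rewrite !inE => /predU1P[-> | /Ib //]; rewrite vc.
- move=> d I indI sub Ij c0d Id /(residual_remove b vc indI sub)[lt|[vI sub']].
    by rewrite geq_min (invd _ I) ?orbT.
  rewrite geq_min (minI d (I :\ v)) //.
  + exact: independentS (subD1set _ _) indI.
  + by move: Ij; rewrite (cardsD1 v) vI => -[].
  + by rewrite -vc; apply: Id.
  + by move=> x; rewrite inE => /andP[_ /Id].
Qed.

(** * Counting the steps of the search *)

Fixpoint visits j := if j is i.+1 then n + h * (visits i + 2) else 0.

(** Either the answer is yes, and rightly so, or control is back at the same node with its
    candidates exhausted. The pop that follows is charged to the parent. *)
Definition finishes (N j : nat) (a : astate) s c0 : Prop :=
  exists2 t, t <= N &
    (answer (iter t astep a) = Some true /\ sbmwis k rho w) \/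
    exists c b, [/\ iter t astep a = AState s c b None, b <= c,
      hopeless j s c0 & prefix_bound j s c0 b].

(** When the node has reached candidate [c], this is the number of children it has had. *)
Definition before s c0 c := #|[set v in residual s c0 | pos v < c]|.

Lemma before_mono s c0 c : before s c0 c <= before s c0 c.+1.
Proof.
apply: subset_leq_card; apply/subsetP => x; rewrite !inE => /andP[-> xc].
by rewrite ltnS ltnW.
Qed.

Lemma before_push s c0 c v : pos v = c -> free s v -> c0 <= c ->
  before s c0 c < before s c0 c.+1.
Proof.
move=> vc vfree c0c; apply: proper_card; apply/properP; split.
  by apply/subsetP => x; rewrite !inE => /andP[-> xc]; rewrite ltnS ltnW.
by exists v; rewrite !inE vc vfree c0c ?leqnn ?ltnn.
Qed.

(* Once [h] residual vertices have been tried, they contain an independent set of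
   size [j.+1], and the bound has dropped below the candidate. *)
Lemma before_lt j s c0 c b : j.+1 <= k -> c0 <= c -> c < b ->
  search_inv j.+1 s c0 c b -> before s c0 c < h.
Proof.
move=> jk c0c cb [_ _ _ invd]; rewrite ltnNge; apply/negP => le_h.
have [I [/subsetP sub indI Ij]] := h_indep le_h jk.
have resI x : x \in I -> x \in residual s c0 /\ pos x < c.
  by move/sub; rewrite inE => /andP[].
have [x xI] : exists x, x \in I by apply/set0Pn; rewrite -card_gt0 Ij.
suff : b <= c by rewrite leqNgt cb.
apply: (invd c I) => // [|y /resI[] //|]; first by apply/subsetP => y /resI[].
by exists x => //; case: (resI x xI).
Qed.

Lemma iter_answer t a : answer a != None -> iter t astep a = a.
Proof. by case: a => s c b [] // r _; elim: t => //= t ->. Qed.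

Lemma search_finishes j s c0 : j + size s = k -> wf_frames c0 s ->
  total s < rho -> c0 <= n ->
  finishes (visits j) j (AState s c0 (if j == 0 then c0 else n) None) s c0.
Proof.
elim: j s c0 => [|j IH] s c0 jk ok tot c0n.
  exists 0 => //; right; exists c0, c0; split=> //=.
    by move=> Y _ _; rewrite leqn0 cards_eq0 => /eqP ->; rewrite big_set0 addn0.
  split=> // _; exists set0; split; rewrite ?sub0set ?cards0 //.
    by apply/independentP => x y; rewrite inE.
  by move=> x; rewrite inE.
(* The claim is generalized to a node in progress. Its potential has two terms: [n - c] pays for
   moving the candidate, and each child still allowed pays for its subtree, one push and one pop. *)
suff loop d c b : n - c = d -> c0 <= c -> search_inv j.+1 s c0 c b ->
    finishes (n - c + (h - before s c0 c) * (visits j + 2)) j.+1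
      (AState s c b None) s c0.
  have [t tN fin] := loop _ c0 n erefl (leqnn _) (search_inv_start _ _ c0n).
  exists t => //; apply: leq_trans tN _.
  by rewrite leq_add ?leq_subr // leq_mul2r leq_subr orbT.
elim: d c b => [|d IHd] c b nc c0c inv; (have [bc|cb] := leqP b c;
  [exists 0 => //; right; exists c, b; have [] := search_inv_done bc tot inv;
    by split |]).
  by case: inv => /andP[_ bn] _ _ _; lia.
have bn : b <= n by case: inv => /andP[].
have cn : c < n by lia.
have [v vc] := pos_onto cn.
have pickv : [pick u | pos u == c] = Some v by rewrite -vc pick_inj //; apply: pos_inj.
have [vfree|nfree] := boolP (free s v); last first.
  have [||t tN fin] := IHd c.+1 b _ _ (search_inv_skip vc nfree inv); try by lia.
  have step1 : astep (AState s c b None) = AState s c.+1 b None.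
    by rewrite /= cb pickv (negPf nfree).
  exists t.+1; last by rewrite iterSr step1.
  apply: leq_ltn_trans tN _; rewrite -(subnSK cn) addSn ltnS leq_add2l leq_mul2r.
  by rewrite leq_sub2l ?orbT // before_mono.
have step1 : astep (AState s c b None) =
    AState ((v, b) :: s) c.+1 (if j == 0 then c.+1 else n)
      (if rho <= total ((v, b) :: s) then Some true else None).
  rewrite /= cb pickv vfree; congr AState; congr (if _ then _ else _).
  by rewrite -jk addSnnS -[X in X == _]add0n eqn_add2r eq_sym.
have ok' : wf_frames c.+1 ((v, b) :: s).
  rewrite /= vc ltnSn bn vfree /=; exact: wf_frames_le ok.
have [tot'|tot'] := leqP rho (total ((v, b) :: s)).
  exists 1; first by rewrite addn_gt0 subn_gt0 cn.
  left; rewrite /iter step1 tot'; split=> //.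
  by apply: wf_frames_sbmwis ok' _ tot'; rewrite /= -jk addSnnS leq_addl.
have jk' : j.+1 <= k by rewrite -jk leq_addr.
have lt_h := before_lt jk' c0c cb inv.
have lt_before := before_push vc vfree c0c.
have [|t tN [[ans sol]|[c1 [b1 [fin1 b1c1 hop pre]]]]] :=
  IH ((v, b) :: s) c.+1 _ ok' tot' cn.
- by rewrite -jk addSnnS.
- exists t.+1; last by left; rewrite iterSr step1 leqNgt tot'.
  (* Fewer than [h] children have been tried, so the share of one more child is available. *)
  have : 1 * (visits j + 2) <= (h - before s c0 c) * (visits j + 2).
    by rewrite leq_mul2r subn_gt0 lt_h orbT.
  by lia.
have [||t2 t2N fin] :=
  IHd c.+1 (minn b1 b) _ _ (search_inv_child vc vfree c0c hop pre inv); try by lia.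
(* One push, [t] steps in the child, one pop, and then the rest of the node. *)
exists (t2 + (t + 2)).
  have : ((h - before s c0 c.+1) + 1) * (visits j + 2) <= (h - before s c0 c) * (visits j + 2).
    by rewrite leq_mul2r; apply/orP; right; lia.
  rewrite mulnDl mul1n; move: t2N; set X := _ * (visits j + 2);
    set Y := _ * (visits j + 2); lia.
rewrite iterD addn2 iterSr -/(iter t.+1 _ _) iterS step1 leqNgt tot' /= fin1.
by rewrite [astep (AState _ _ _ _)]/= ltnNge b1c1 /= vc.
Qed.

(** The shift by [n + 4] makes the recurrence purely geometric: the inductive step needs only
    [2 * (n + 2) <= h * (n + 2)]. *)
Lemma visits_le j : 1 < h -> visits j + (n + 4) <= 2 * (n + 2) * h ^ j.
Proof.
move=> h2; elim: j => [|j IH]; first by rewrite expn0 /visits; lia.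
rewrite -[visits _]/(n + h * (visits j + 2)) expnS mulnCA;
  apply: leq_trans (leq_mul (leqnn h) IH).
have : 2 * (n + 2) <= h * (n + 2) by rewrite leq_mul2r h2 orbT.
by rewrite !mulnDr; lia.
Qed.

(** For [h = 1] the recurrence of [visits] grows linearly in the budget while [h ^ k] stays 1; the
    disjunction then leaves only [k = 1] and the empty graph. *)
Lemma search_answer : 0 < h -> [|| 1 < h, k == 1 | n == 0] ->
  exists2 t, t <= 2 * (n + 2) * h ^ k &
    answer (iter t astep (AState [::] 0 (if k == 0 then 0 else n) None)) =
      Some (sbmwis k rho w).
Proof.
move=> h0 hyp.
have tot0 : total [::] < rho by rewrite /total big_nil.
have [t tN fin] := @search_finishes k [::] 0 (addn0 k) isT tot0 (leq0n _).
have E0 : 0 < h ^ k by rewrite expn_gt0 h0.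
have [n0|n_gt0] := posnP n.
  (* Without vertices the initial state has neither a candidate nor a frame, so one step answers no;
     this is right because [rho] is positive. *)
  exists 1; first by nia.
  rewrite n0 if_same /=; congr Some; apply/esym/negbTE/negP => /existsP[S /and3P[_ _]].
  rewrite big1 => [|v _]; first by rewrite leqNgt rho_gt0.
  by have := pos_lt v; rewrite n0.
have tN' : t.+1 <= 2 * (n + 2) * h ^ k.
  case/or3P: hyp => [h2|/eqP k1|/eqP n0].
  - by have := visits_le k h2; lia.
  - by move: tN; rewrite k1 /= expn1; nia.
  - by rewrite n0 in n_gt0.
case: fin => [[ans sol]|[c [b [fin bc hop pre]]]].
  by exists t; [exact: ltnW | rewrite ans sol].
(* The extra step turns exhaustion of the root into the answer no. The residual graph of the root is
   all of [G], so [hopeless] excludes every solution. *)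
exists t.+1 => //; rewrite iterS fin /= ltnNge bc /=; congr Some.
apply/esym/negbTE/negP => /existsP[S /and3P[indS Sk]].
rewrite leqNgt => /negP; apply.
have := hop S indS _ Sk; rewrite {1}/total big_nil; apply.
by apply/subsetP => x _; rewrite inE.
Qed.

End Search.

(** * The program and its simulation *)

Local Notation rN := 2.
Local Notation rM := 3.
Local Notation rRho := 4.
Local Notation rOne := 5.
Local Notation rTwo := 6.
Local Notation rWts := 7.
Local Notation rEdges := 8.
Local Notation rOrd := 9.
Local Notation rMark := 10.
Local Notation rStk := 11.
Local Notation rJ := 12.
Local Notation rSp := 13.
Local Notation rC := 14.
Local Notation rB := 15.
Local Notation rW := 16.
Local Notation rRun := 17.
Local Notation rI := 18.
Local Notation rT := 19.
Local Notation rU := 20.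
Local Notation rA := 21.
Local Notation rD := 22.
Local Notation rD' := 23.
Local Notation rX := 24.
Local Notation rY := 25.
Local Notation rOk := 26.
Local Notation rV := 27.
Local Notation rTv := 28.
Local Notation rWv := 29.
Local Notation rR := 30.

Arguments upd h a v b /.

Definition skip := Blk [::].

(** Registers start at 0, so [rZ] serves at once as address 0 and as a constant. The working areas
    are placed behind the input word. *)
Definition setup : com :=
  Blk [:: Const rOne 1; Const rTwo 2; Const rWts 4; Read rN rZ; Read rM rOne;
    Read rJ rTwo; Const rA 3; Read rRho rA; Add rEdges rWts rN;
    Add rOrd rEdges rM; Add rOrd rOrd rM; Add rMark rOrd rN; Add rStk rMark rN;
    Const rV 0; Add rTv rN rZ].

(** [rR] counts the vertices that are heavier than the current one, or equally heavy with a smaller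
    number. *)
Definition rank_step : com :=
  Blk [:: Add rA rWts rU; Read rX rA; Sub rD rX rWv];;
  Ifz rD
    (Blk [:: Sub rD rWv rX];;
     Ifz rD
       (Blk [:: Sub rD rV rU];; Ifz rD skip (Blk [:: Add rR rR rOne]))
       skip)
    (Blk [:: Add rR rR rOne]);;
  Blk [:: Add rU rU rOne; Sub rT rT rOne].

(** Ranks are distinct, so every vertex can be written directly to its final cell of the order
    table. *)
Definition sort_step : com :=
  Blk [:: Add rA rWts rV; Read rWv rA; Const rR 0; Const rU 0; Add rT rN rZ];;
  While rT rank_step;;
  Blk [:: Add rA rOrd rR; Write rA rV; Add rV rV rOne; Sub rTv rTv rOne].

(** Two numbers are equal when both truncated differences vanish. Either end of the edge may be the
    candidate; the other end must then be unmarked. *)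
Definition edge_step : com :=
  Blk [:: Read rX rI; Add rI rI rOne; Read rY rI; Add rI rI rOne; Sub rT rT rOne;
    Sub rD rX rU; Sub rD' rU rX; Add rD rD rD'];;
  Ifz rD
    (Blk [:: Add rA rMark rY; Read rD rA];; Ifz rD skip (Blk [:: Const rOk 0]))
    skip;;
  Blk [:: Sub rD rY rU; Sub rD' rU rY; Add rD rD rD'];;
  Ifz rD
    (Blk [:: Add rA rMark rX; Read rD rA];; Ifz rD skip (Blk [:: Const rOk 0]))
    skip.

(** The minimum of two bounds is obtained as [b - (b - x)]. An empty stack stops the search with the
    result register still 0. *)
Definition pop : com :=
  Blk [:: Sub rD rSp rStk];;
  Ifz rD
    (Blk [:: Const rRun 0])
    (Blk [:: Sub rSp rSp rTwo; Read rC rSp; Add rA rSp rOne; Read rX rA;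
       Sub rD rB rX; Sub rB rB rD; Add rA rOrd rC; Read rU rA; Add rA rWts rU;
       Read rX rA; Sub rW rW rX; Add rA rMark rU; Write rA rZ; Add rJ rJ rOne;
       Add rC rC rOne]).

Definition push : com :=
  Blk [:: Add rA rWts rU; Read rX rA; Add rW rW rX; Write rSp rC; Add rA rSp rOne;
    Write rA rB; Add rSp rSp rTwo; Add rA rMark rU; Write rA rOne; Add rC rC rOne;
    Sub rJ rJ rOne];;
  Ifz rJ (Blk [:: Add rB rC rZ]) (Blk [:: Add rB rN rZ]);;
  Blk [:: Sub rD rRho rW];;
  Ifz rD (Blk [:: Const rRes 1; Const rRun 0]) skip.

Definition search_step : com :=
  Blk [:: Sub rD rB rC];;
  Ifz rD pop
    (Blk [:: Add rA rOrd rC; Read rU rA; Const rOk 1; Add rI rEdges rZ;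
       Add rT rM rZ];;
     While rT edge_step;;
     Ifz rOk (Blk [:: Add rC rC rOne]) push).

Definition solver : com :=
  setup;;
  While rTv sort_step;;
  Blk [:: Const rC 0; Add rB rN rZ; Const rW 0; Add rSp rStk rZ; Const rRun 1];;
  While rRun search_step.

Definition keeps_consts (c : com) := all (fun r => keeps r c) (iota 1 11).

Section Simulation.

Variables (G : sgraph) (w : G -> nat) (k rho : nat).
Variables (vs : seq G) (es : seq (G * G)).
Hypothesis vs_enum : perm_eq vs (enum G).
Hypothesis es_edges : perm_eq [seq [set e.1; e.2] | e <- es] (enum (edges G)).
Hypothesis k_gt0 : 0 < k.

Local Notation n := #|G|.
Local Notation m := #|edges G|.
(* The edges start at address [oE], the vertices in the order of [pos] at [oO], the
   flags of the chosen vertices at [oM], and the stack of frames at [oS]. *)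
Let oE := 4 + n.
Let oO := oE + m + m.
Let oM := oO + n.
Let oS := oM + n.

Definition input : seq nat :=
  [:: n; m; k; rho] ++ [seq w v | v <- vs]
    ++ flatten [seq [:: index e.1 vs; index e.2 vs] | e <- es].
Local Notation inp := (nth 0 input).
Local Notation idx v := (index v vs).

Lemma mem_vs v : v \in vs.
Proof. by rewrite (perm_mem vs_enum) mem_enum. Qed.

Lemma size_vs : size vs = n.
Proof. by rewrite (perm_size vs_enum) cardE. Qed.

Lemma size_es : size es = m.
Proof. by have := perm_size es_edges; rewrite size_map -cardE. Qed.

Lemma idx_lt v : idx v < n.
Proof. by rewrite -size_vs index_mem mem_vs. Qed.

Lemma idx_inj u v : (idx u == idx v) = (u == v).
Proof.
apply/eqP/eqP => [E|-> //].
by rewrite -(nth_index u (mem_vs u)) E nth_index ?mem_vs.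
Qed.

Lemma idx_onto i : i < n -> exists v, idx v = i.
Proof.
rewrite -size_vs => i_lt; case: vs vs_enum i_lt => // v0 vs' vsE i_lt.
exists (nth v0 (v0 :: vs') i); rewrite index_uniq // (perm_uniq vsE).
exact: enum_uniq.
Qed.

Lemma inp_w v : inp (4 + idx v) = w v.
Proof.
rewrite /input nth_cat /= add4n nth_cat size_map size_vs.
rewrite !subSS subn0 idx_lt (nth_map v) ?nth_index ?mem_vs //.
by rewrite size_vs idx_lt.
Qed.

Lemma nth_flatten_pairs (T : Type) (f g : T -> nat) (l : seq T) (x0 : T) i :
  i < size l ->
  nth 0 (flatten [seq [:: f e; g e] | e <- l]) (i + i) = f (nth x0 l i) /\
  nth 0 (flatten [seq [:: f e; g e] | e <- l]) (i + i).+1 = g (nth x0 l i).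
Proof. by elim: l i => // e l IH [|i] //= /IH; rewrite addnS. Qed.

Lemma inp_edge e0 i : i < m ->
  inp (oE + (i + i)) = idx (nth e0 es i).1 /\
  inp (oE + (i + i)).+1 = idx (nth e0 es i).2.
Proof.
rewrite -size_es => i_lt;
  have [E1 E2] := nth_flatten_pairs (fun e => idx e.1) (fun e => idx e.2) e0 i_lt.
rewrite -E1 -E2 /input !nth_cat /= /oE !add4n !addSn !subSS !subn0 size_map size_vs.
by split; rewrite ltnNge -?[(n + _).+1]addnS leq_addr /= addKn.
Qed.

Lemma inp_out a : oO <= a -> inp a = 0.
Proof.
move=> le_a; rewrite nth_default //; apply: leq_trans le_a.
rewrite /input !size_cat /= size_map size_vs /oO /oE -size_es.
suff -> : size (flatten [seq [:: idx e.1; idx e.2] | e <- es]) = size es + size es by lia.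
by elim: es => //= e l ->; lia.
Qed.

(** * The vertices ordered by decreasing weight *)

Definition earlier (u v : nat) : bool :=
  (inp (4 + v) < inp (4 + u)) || ((inp (4 + u) == inp (4 + v)) && (u < v)).

(** The rank in a strict total order, ties in weight being broken by vertex number; hence a
    bijection onto the numbers below [n]. *)
Definition pos (v : G) : nat := count (fun u => earlier u (idx v)) (iota 0 n).

Lemma earlier_trans : transitive earlier.
Proof. by rewrite /earlier => v u t; move: (inp _) (inp _) (inp _); lia. Qed.

Lemma pos_mono u v : earlier (idx u) (idx v) -> pos u < pos v.
Proof.
move=> uv; rewrite /pos -!size_filter.
set A := filter _ _; set B := filter _ _.
have : size (idx u :: A) <= size B; last by [].
apply: uniq_leq_size => [|t].
  rewrite /= filter_uniq ?iota_uniq // andbT mem_filter negb_and.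
  by rewrite /earlier !ltnn andbF.
rewrite inE => /predU1P[->|]; rewrite !mem_filter mem_iota.
  by rewrite uv add0n idx_lt.
by case/andP=> tu ->; rewrite (earlier_trans tu uv).
Qed.

Lemma earlier_total u v : u != v -> earlier (idx u) (idx v) || earlier (idx v) (idx u).
Proof. by rewrite -idx_inj /earlier; lia. Qed.

Lemma pos_inj : injective pos.
Proof.
move=> u v E; apply/eqP; apply: contraT => /earlier_total.
by case/orP => /pos_mono; rewrite E ltnn.
Qed.

Lemma pos_lt v : pos v < n.
Proof.
rewrite /pos -[X in _ < X](size_iota 0) -(count_predC (fun u => earlier u (idx v))).
rewrite -[X in X < _]addn0 ltn_add2l -has_count; apply/hasP; exists (idx v).
  by rewrite mem_iota idx_lt.
by rewrite /= /earlier !ltnn andbF.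
Qed.

Lemma pos_onto c : c < n -> exists v, pos v = c.
Proof.
move=> c_lt; pose g v : 'I_n := Ordinal (pos_lt v).
have g_inj : injective g by move=> u v [] /pos_inj.
have : Ordinal c_lt \in codom g by apply: inj_card_onto => //; rewrite card_ord.
by case/codomP => v [->]; exists v.
Qed.

Lemma pos_w u v : pos u <= pos v -> w v <= w u.
Proof.
apply: contraTT; rewrite -!ltnNge -!inp_w => lt; apply: pos_mono.
by rewrite /earlier lt.
Qed.

(** * Testing a candidate against the chosen vertices *)

Definition marked (s : seq (G * nat)) (v : G) : bool := v \in map fst s.

(** Edge [i] joins [u] to a marked vertex, in either orientation. *)
Definition hit (M : nat -> nat) (u i : nat) : bool :=
  ((M (oE + (i + i)) == u) && (M (oM + M (oE + (i + i)).+1) != 0)) ||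
  ((M (oE + (i + i)).+1 == u) && (M (oM + M (oE + (i + i))) != 0)).

Lemma adj_es u v : adj u v = has (fun e => (e == (u, v)) || (e == (v, u))) es.
Proof.
have -> : adj u v = ([set u; v] \in edges G).
  apply/idP/imsetP => [uv|[[a b]]]; first by exists (u, v); rewrite ?inE.
  rewrite inE /= => ab E; have neq : a != b by apply: contraTneq ab => ->;
    rewrite adj_irr.
  have uE : u \in [set a; b] by rewrite -E !inE eqxx.
  have vE : v \in [set a; b] by rewrite -E !inE eqxx orbT.
  have aE : a \in [set u; v] by rewrite E !inE eqxx.
  have bE : b \in [set u; v] by rewrite E !inE eqxx orbT.
  move: uE vE aE bE neq; rewrite !inE => /orP[]/eqP-> /orP[]/eqP->;
    rewrite ?(adj_sym b a) // !orbb ?(eq_sym b a); by case: (a == b).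
rewrite -mem_enum -(perm_mem es_edges).
apply/mapP/hasP => [[[a b] ab E]|[e e_es /orP[]/eqP ee]]; last 2 first.
- by exists e; rewrite // ee.
- by exists e; rewrite // ee setUC.
exists (a, b) => //=.
have aE : a \in [set u; v] by rewrite E !inE eqxx.
have bE : b \in [set u; v] by rewrite E !inE eqxx orbT.
have uE : u \in [set a; b] by rewrite -E !inE eqxx.
have vE : v \in [set a; b] by rewrite -E !inE eqxx orbT.
move: aE bE uE vE; rewrite !inE !xpair_eqE ![u == _]eq_sym ![v == _]eq_sym.
by case: (a == u); case: (a == v); case: (b == u); case: (b == v).
Qed.

Lemma hit_free (M : nat -> nat) s v :
  (forall a, a < oO -> M a = inp a) ->
  (forall u, M (oM + idx u) = marked s u) ->
  all (fun i => ~~ hit M (idx v) i) (iota 0 m) = free s v.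
Proof.
move=> M_inp M_mark.
have M_inp_edge i : i < m ->
    M (oE + (i + i)) = inp (oE + (i + i)) /\ M (oE + (i + i)).+1 = inp (oE + (i + i)).+1.
  by move=> i_lt; split; apply: M_inp; rewrite /oO; lia.
apply/allP/allP => [nohit [u b] /= us|nadj i].
  rewrite adj_es; apply/hasPn => e e_es; have := nohit (index e es).
  have i_lt : index e es < m by rewrite -size_es index_mem.
  have [E1 E2] := inp_edge e i_lt.
  rewrite mem_iota add0n leq0n => /(_ i_lt); rewrite /hit.
  have [M1 M2] := M_inp_edge _ i_lt; rewrite M1 M2 E1 E2.
  rewrite !M_mark !nth_index // !idx_inj; apply: contra.
  have um : marked s u by apply/mapP; exists (u, b).
  by case/orP => /eqP -> /=; rewrite um eqxx ?orbT.
rewrite mem_iota add0n leq0n => /= i_lt.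
have e0 : G * G by case: (es) (size_es) i_lt => [<- //|e0].
have [E1 E2] := inp_edge e0 i_lt; set e := nth e0 es i in E1 E2 *.
have e_es : e \in es by rewrite mem_nth // size_es.
have [M1 M2] := M_inp_edge _ i_lt; rewrite /hit M1 M2 E1 E2.
rewrite !M_mark !idx_inj; apply/negP => /orP[]/andP[/eqP ev];
  rewrite eqb0 negbK => /mapP[p ps pe]; have := nadj p ps;
  rewrite adj_es => /hasPn/(_ e e_es); rewrite -pe -ev -surjective_pairing.
  by rewrite eqxx.
by rewrite eqxx orbT.
Qed.

Lemma iota0S i : iota 0 i.+1 = iota 0 i ++ [:: i].
Proof. by rewrite -addn1 iotaD. Qed.

Definition consts (R : nat -> nat) : Prop := forall r, 0 < r < 12 ->
  R r = nth 0 [:: 0; 0; n; m; rho; 1; 2; 4; oE; oO; oM; oS] r.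

Lemma runs_consts c s T (Q : state -> Prop) :
  runs c s T Q -> consts s.1 -> keeps_consts c ->
  runs c s T (fun s' => consts s'.1 /\ Q s').
Proof.
move=> /runs_frame/runs_weak run_c sc /allP cc; apply: run_c => // s' [Qs' keep _];
  split=> // r r_lt.
by rewrite keep ?sc //; apply: cc; rewrite mem_iota; lia.
Qed.

Lemma rank_loop v s :
  consts s.1 -> (forall a, a < oO -> s.2 a = inp a) ->
  s.1 rV = idx v -> s.1 rWv = w v -> s.1 rR = 0 -> s.1 rU = 0 -> s.1 rT = n ->
  runs (While rT rank_step) s (n * 22).+1 (fun s' => s'.1 rR = pos v).
Proof.
move=> sc sM sV sWv sR sU sT.
pose Inv i (s' : state) := [/\ consts s'.1, s'.2 = s.2,
  s'.1 rV = idx v & s'.1 rWv = w v] /\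
  [/\ s'.1 rU = i, s'.1 rT = n - i &
    s'.1 rR = count (fun u => earlier u (idx v)) (iota 0 i)].
apply: (@runs_weak (n * 22).+1 _ _ _ (Inv n)) => // [|s' [_ []//]].
apply: runs_while => [|i s' _ [_ [_ -> _]]|i [R M] i_lt].
- by split=> //; split=> //; rewrite ?subn0.
- by lia.
rewrite /Inv /= => -[[Rc -> RV RWv] [RU RT RR]].
suff : runs rank_step (R, s.2) 20 (fun s' => [/\ s'.2 = s.2, s'.1 rV = idx v &
   s'.1 rWv = w v] /\ [/\ s'.1 rU = i.+1, s'.1 rT = n - i.+1 &
    s'.1 rR = count (fun u => earlier u (idx v)) (iota 0 i.+1)]).
  move=> /runs_consts/(_ Rc isT)/runs_weak; apply=> // s' [c' [[? ? ?] ?]]; by split.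
have RO := Rc 5 isT; have RWt := Rc 7 isT; rewrite /= in RO RWt.
apply: runs_den; rewrite // iota0S count_cat /= addn0 -RR /earlier -RU.
rewrite (inp_w v) RWt sM ?RWv; last by rewrite /oO /oE; lia.
case: eqP => /= d1; [case: eqP => /= d2; [case: eqP => /= d3|]|];
  (do 2![split=> //=]; rewrite ?RT; lia).
Qed.

(** The cells from [oM] on have to remain 0 because the search starts with all marks cleared. *)
Definition sort_inv i (s : state) : Prop :=
  consts s.1 /\
  [/\ s.1 rV = i, s.1 rTv = n - i, s.1 rJ = k & s.1 rRes = 0] /\
  [/\ forall a, a < oO -> s.2 a = inp a,
      forall v, idx v < i -> s.2 (oO + pos v) = idx v &
      forall a, oM <= a -> s.2 a = 0].

Lemma sort_step_inv i s : i < n -> sort_inv i s ->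
  runs sort_step s (5 + ((n * 22).+1 + 4)) (sort_inv i.+1).
Proof.
case: s => R M i_lt [/= Rc [[RV RT RJ RR] [M_inp M_ord M_0]]].
have [v iv] := idx_onto i_lt; rewrite -iv in RV.
have [RO RWt RN ROr] := And4 (Rc 5 isT) (Rc 7 isT) (Rc 2 isT) (Rc 9 isT).
rewrite /= in RO RWt RN ROr.
pose Q (s : state) := [/\ s.1 rV = i.+1, s.1 rTv = n - i.+1, s.1 rJ = k & s.1 rRes = 0] /\
  [/\ forall a, a < oO -> s.2 a = inp a,
      forall v, idx v < i.+1 -> s.2 (oO + pos v) = idx v &
      forall a, oM <= a -> s.2 a = 0].
suff : runs sort_step (R, M) (5 + ((n * 22).+1 + 4)) Q.
  by move/runs_consts => /(_ Rc isT)/runs_weak; apply.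
apply: runs_seq; apply: runs_blk => //=.
set s1 := (X in runs _ X _ _).
have s1c : consts s1.1.
  by move=> r r_lt; rewrite /s1 /= -Rc //; do !case: eqP => //; lia.
apply: runs_seq; have := @rank_loop v s1 s1c M_inp.
rewrite /s1 /= RN RWt RV M_inp ?inp_w; last by have := idx_lt v; rewrite /oO /oE; lia.
move=> /(_ erefl erefl erefl erefl); rewrite (Rc 1 isT) addn0 => /(_ erefl).
move=> /runs_frame/runs_weak; apply=> // -[R1 M1] /= [RR1 keep /(_ isT) ->].
apply: runs_blk => //;
  rewrite /Q /= (keep rV) // (keep rTv) // (keep rJ) // (keep rRes) // (keep rOrd)
    // (keep rOne) //= RR1 ROr RO RV RT.
split; first by rewrite iv; split=> //; lia.
have v_lt := pos_lt v.
split=> [a a_lt|u|a a_ge].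
- by rewrite M_inp //; case: eqP => // E; lia.
(* Injectivity of [pos] protects the entries written earlier. *)
- rewrite eqn_add2l; case: eqP => [/pos_inj -> //|uv];
    rewrite ltnS leq_eqVlt => /orP[|/M_ord //].
  by rewrite -iv idx_inj => /eqP uv'; case: uv; rewrite uv'.
- by rewrite M_0 //; case: eqP => // E; move: a_ge; rewrite /oM; lia.
Qed.

Lemma sort_runs s : sort_inv 0 s ->
  runs (While rTv sort_step) s (n * (5 + ((n * 22).+1 + 4)).+2).+1 (sort_inv n).
Proof.
move=> s0; apply: (runs_while (Inv := sort_inv)) => // i s'; last exact: sort_step_inv.
by move=> _ [_ [[_ -> _ _] _]]; lia.
Qed.

Lemma setup_inv : sort_inv 0 (den setup ((fun => 0), inp)).
Proof.
split; last first.
  split; first by split; rewrite /= ?addn0 ?subn0.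
  by split=> // a le_a; apply: inp_out; apply: leq_trans le_a; apply: leq_addr.
by case=> [|[|[|[|[|[|[|[|[|[|[|[|r]]]]]]]]]]]].
Qed.

Lemma edge_loop v F s :
  consts s.1 -> (forall a, a < oO -> s.2 a = inp a) ->
  (forall u, s.2 (oM + idx u) = marked F u) ->
  s.1 rU = idx v -> s.1 rOk = 1 -> s.1 rI = oE -> s.1 rT = m ->
  runs (While rT edge_step) s (m * 32).+1 (fun s' => s'.1 rOk = free F v).
Proof.
move=> sc sM sK sU sOk sI sT.
pose Q i (s' : state) := [/\ s'.2 = s.2, s'.1 rU = idx v, s'.1 rI = oE + (i + i),
    s'.1 rT = m - i & s'.1 rOk = all (fun i => ~~ hit s.2 (idx v) i) (iota 0 i)].
pose Inv i (s' : state) := consts s'.1 /\ Q i s'.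
apply: (@runs_weak (m * 32).+1 _ _ _ (Inv m)) => // [|s' [_ [_ _ _ _ ->]]]; last first.
  by rewrite (hit_free _ sM sK).
apply: runs_while => [|i s' _ [_ [_ _ _ -> _]]|i [R M] i_lt].
- by split=> //; split; rewrite ?subn0 ?addn0.
- by lia.
rewrite /Inv /= => -[Rc [/= -> RU RI RT ROk]].
suff : runs edge_step (R, s.2) 30 (Q i.+1).
  by move=> /runs_consts/(_ Rc isT)/runs_weak; apply.
have RO := Rc 5 isT; have RK := Rc 10 isT; rewrite /= in RO RK.
apply: runs_den => //.
rewrite /Q iota0S all_cat [all _ [:: i]]/= andbT; move: ROk;
  set A := all _ (iota 0 i) => ROk.
have eqE (x y : nat) : (x == y) = (x - y + (y - x) == 0) by lia.
have -> : hit s.2 (idx v) i =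
    (s.2 (R rI) - R rU + (R rU - s.2 (R rI)) == 0) &&
    (s.2 (R rMark + s.2 (R rI + R rOne)) != 0) ||
    (s.2 (R rI + R rOne) - R rU + (R rU - s.2 (R rI + R rOne)) == 0) &&
    (s.2 (R rMark + s.2 (R rI)) != 0).
  by rewrite -!eqE /hit RU RI RK RO addn1.
have E : R rI + R rOne + R rOne = oE + (i.+1 + i.+1).
  by rewrite RI RO !addn1 addSn addnS !addnS.
have T : R rT - R rOne = m - i.+1 by rewrite RT RO subn1 subnS.
rewrite /=; case: (_ - R rU + _ == 0) => /=.
all: [> case: (s.2 (R rMark + s.2 (R rI + R rOne)) == 0) => /= |].
all: case: (_ - R rU + _ == 0) => /=.
all: try case: (s.2 (R rMark + s.2 (R rI)) == 0) => /=.
all: split; rewrite ?andbT ?andbF ?ROk //.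
Qed.

(** * Simulation of the abstract machine *)

Fixpoint stored (M : nat -> nat) (F : seq (G * nat)) : Prop :=
  if F is (v, b) :: F' then
    let a := oS + (size F' + size F') in
    [/\ M a = pos v, M a.+1 = b & stored M F']
  else True.

Lemma stored_upd M F a x : a < oS \/ oS + (size F + size F) <= a ->
  stored M F -> stored (upd M a x) F.
Proof.
elim: F => //= -[v b] F IH /= a_out [Mv Mb MF].
rewrite !ifN; try by apply/eqP; lia.
by split=> //; apply: IH => //; lia.
Qed.

(** Once there is an answer, only the constants, the run flag and the result matter. The clause for
    [size F = k] says that a full stack is never pushed on, which keeps the budget register from
    being truncated at 0. *)
Definition simulates (a : astate G) (s : state) : Prop :=
  let: AState F c b r := a in
  [/\ consts s.1, s.1 rRun = (r == None), s.1 rRes = (r == Some true) &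
   r = None ->
   [/\ [/\ s.1 rC = c, s.1 rB = b, s.1 rW = total w F,
         s.1 rSp = oS + (size F + size F) & s.1 rJ + size F = k],
      [/\ wf_frames pos c F, b <= n & size F = k -> b <= c] &
      [/\ forall a, a < oO -> s.2 a = inp a,
          forall v, s.2 (oO + pos v) = idx v,
          forall v, s.2 (oM + idx v) = marked F v &
          stored s.2 F]]].

Local Notation step := (astep w pos k rho).

Lemma pop_simulates F c b s : b <= c -> simulates (AState F c b None) s ->
  runs pop s 20 (simulates (step (AState F c b None))).
Proof.
case: s => R M bc [/= Rc Rrun Rres /(_ erefl)].
move=> [[RC RB RW RSp RJ] [ok bn full] [M_inp M_ord M_mark M_stk]].
rewrite ltnNge bc /=.
suff : runs pop (R, M) 20 (fun s' => consts s'.1 ->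
    simulates match F with
      | [::] => AState F c b (Some false)
      | (v, b') :: s' => AState s' (pos v).+1 (minn b b') None
      end s').
  by move=> /runs_consts/(_ Rc isT)/runs_weak; apply=> // s' [? H]; exact: H.
have RO := Rc 5 isT; have RT := Rc 6 isT; have RStk := Rc 11 isT.
have RZ := Rc 1 isT; have RK := Rc 10 isT; have ROr := Rc 9 isT; have RWt := Rc 7 isT.
rewrite /= in RO RT RStk RZ RK ROr RWt.
apply: runs_den => //=; rewrite RSp RStk addKn.
case: F RW RSp RJ ok full M_mark M_stk => [|[v b'] F] /= RW RSp RJ ok full M_mark M_stk.
  by move=> s'c; split.
have [Mv Mb MF] := M_stk; have /and4P[vc b'n vF okF] := ok.
have topE : oS + ((size F).+1 + (size F).+1) - 2 = oS + (size F + size F) by lia.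
have w_v : M (4 + idx v) = w v.
  by rewrite M_inp ?inp_w //; have := idx_lt v; rewrite /oO /oE; lia.
rewrite ?addSn /= => s'c; split=> //= _; rewrite RSp RT topE Mv ROr RWt M_ord w_v.
split.
- by rewrite RO !addn1 Mb RB RW /total big_cons addKn; split=> //; lia.
- rewrite (leq_trans (geq_minl _ _) bn); split=> //; last by move=> ?; lia.
  exact: wf_frames_le okF.
- rewrite RK RZ; split.
  + by move=> a a_lt; rewrite M_inp //; case: eqP => // E; lia.
  + by move=> u; rewrite M_ord; case: eqP => // E; have := pos_lt u; lia.
  (* The popped vertex occurs only once on the stack, so clearing its mark is correct. *)
  + move=> u; rewrite eqn_add2l M_mark /marked inE idx_inj.
    case: eqP => [->|_ //].
    have okvF : wf_frames pos c ((v, b') :: F) by [].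
    by have := wf_frames_uniq okvF; rewrite /= => /andP[/negPf-> _].
  + by apply: stored_upd => //; left; have := idx_lt v; lia.
Qed.

Lemma push_memory M F c b v :
  (forall a, a < oO -> M a = inp a) -> (forall u, M (oO + pos u) = idx u) ->
  (forall u, M (oM + idx u) = marked F u) -> stored M F -> pos v = c ->
  let a := oS + (size F + size F) in
  let M' := upd (upd (upd M a c) a.+1 b) (oM + idx v) 1 in
  [/\ forall a, a < oO -> M' a = inp a, forall u, M' (oO + pos u) = idx u,
      forall u, M' (oM + idx u) = marked ((v, b) :: F) u & stored M' ((v, b) :: F)].
Proof.
move=> M_inp M_ord M_mark M_stk vc a M'; have v_lt := idx_lt v; rewrite /M' /a; split.
- by move=> a' a_lt /=; rewrite !ifN ?M_inp //; apply/eqP; lia.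
- by move=> u /=; have u_lt := pos_lt u; rewrite !ifN ?M_ord //; apply/eqP; lia.
- move=> u /=; have u_lt := idx_lt u; rewrite eqn_add2l idx_inj /marked inE.
  by case: eqP => //= _; rewrite !ifN ?M_mark //; apply/eqP; lia.
- split; last by do 2![apply: stored_upd; first lia]; apply: stored_upd => //; lia.
    by rewrite /= vc; do 2![case: eqP => [?|_]; first lia]; rewrite eqxx.
  by rewrite /=; case: eqP => [?|_]; [lia | rewrite eqxx].
Qed.

Lemma push_simulates F c b v s : c < b -> pos v = c -> free F v ->
  simulates (AState F c b None) s -> s.1 rU = idx v ->
  runs push s 30 (simulates (step (AState F c b None))).
Proof.
case: s => R M cb vc vF [/= Rc Rrun Rres /(_ erefl)].
move=> [[RC RB RW RSp RJ] [ok bn full] [M_inp M_ord M_mark M_stk]] RU.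
have pickv : [pick u | pos u == c] = Some v by rewrite -vc pick_inj //; apply: pos_inj.
rewrite cb pickv vF; set r := if rho <= _ then _ else _.
set b1 := if _ == k then _ else _.
have RO := Rc 5 isT; have RT := Rc 6 isT; have RK := Rc 10 isT; have RWt := Rc 7 isT.
rewrite /= in RO RT RK RWt.
have w_v : M (4 + idx v) = w v.
  by rewrite M_inp ?inp_w //; have := idx_lt v; rewrite /oO /oE; lia.
set F1 := (v, b) :: F in r *;
  set M1 := upd (upd (upd M (R rSp) c) (R rSp).+1 b) (oM + idx v) 1.
pose Q b' (s : state) := [/\ s.1 rC = c.+1, s.1 rB = b', s.1 rW = total w F1,
    s.1 rSp = oS + (size F1 + size F1) & s.1 rJ + size F1 = k] /\
  [/\ s.1 rRun = 1, s.1 rRes = 0 & s.2 = M1].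
rewrite /push; set A := Blk _; set B := Ifz rJ _ _; set D := Blk _.
have runA : runs A (R, M) 11 (Q b).
  apply: runs_blk => //=; split; split=> //=.
  - by rewrite RC RO addn1.
  - by rewrite RW RWt RU w_v /total big_cons addnC.
  - by rewrite RSp RT; lia.
  (* As [c < b], the stack is not full, the budget is positive and the subtraction is exact. *)
  - by rewrite -RJ RO; move: full; rewrite /= -RJ; lia.
  - by rewrite RO RK RU RC RB addn1.
apply: (@runs_seq 11 19); move/runs_consts: runA => /(_ Rc isT)/runs_weak; apply=> //.
move=> s1 [sc1 [[C1 B1 W1 Sp1 J1] [run1 res1 M1E]]].
have runB : runs B s1 3 (Q b1).
  have RZ := sc1 1 isT; have RN := sc1 2 isT; rewrite /= in RZ RN.
  have -> : b1 = if s1.1 rJ == 0 then c.+1 else n.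
    by rewrite /b1 -J1 -[X in X == _]add0n eqn_add2r eq_sym.
  apply: runs_den => //=; case: ifP => _; split; split=> //=;
    first by rewrite C1 RZ addn0.
  by rewrite RN RZ addn0.
apply: (@runs_seq 3 16); move/runs_consts: runB => /(_ sc1 isT)/runs_weak; apply=> //.
move=> s2 [sc2 [[C2 B2 W2 Sp2 J2] [run2 res2 M2E]]].
have [b1n full'] : b1 <= n /\ ((size F).+1 = k -> b1 <= c.+1).
  rewrite /b1; split=> [|->]; last by rewrite eqxx.
  by case: ifP => _ //; exact: leq_trans bn.
apply: (@runs_weak 16 _ _ _ (fun s' => consts s'.1 /\ (consts s'.1 ->
    simulates (AState F1 c.+1 b1 r) s'))) => // [|s' [? H]]; last exact: H.
apply: runs_consts => //; apply: runs_den => //.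
have RRho := sc2 4 isT; rewrite /= in RRho.
rewrite /= RRho W2 subn_eq0 /r; case: ifP => /= _ sc3; split=> // _.
rewrite M2E /M1 RSp; split=> //; last exact: push_memory.
by rewrite /= vc ltnSn bn vF /=.
Qed.

Lemma search_step_simulates a s : answer a = None -> simulates a s ->
  runs search_step s (1 + (5 + ((m * 32).+1 + 32)).+2) (simulates (step a)).
Proof.
case: a => F c b ?; rewrite [answer _]/= => -> sim.
have [sc Rrun Rres /(_ erefl)] := sim.
move=> [[sC sB sW sSp sJ] [ok bn full] [M_inp M_ord M_mark M_stk]].
have RStk := sc 11 isT; have RZ := sc 1 isT; have RM := sc 3 isT; have ROr := sc 9 isT.
have RE := sc 8 isT; rewrite /= in RStk RZ RM ROr RE.
apply: runs_seq; apply: runs_blk => //.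
set s1 := foldl _ _ _.
have sim1 : simulates (AState F c b None) s1.
  split=> // r r_lt.
  by rewrite /s1 /= -sc //; case: eqP => //; lia.
apply: runs_if; have -> : s1.1 rD = b - c by rewrite /s1 /= sB sC.
case: eqP => /eqP; rewrite subn_eq0 => bc.
  apply: runs_weak (pop_simulates bc sim1) _ _ => //.
  by lia.
have cb : c < b by rewrite ltnNge.
have [v vc] := pos_onto (leq_trans cb bn).
apply: runs_seq; apply: runs_blk => //; rewrite /s1.
set s2 := foldl _ _ _.
have sim2 : simulates (AState F c b None) s2.
  split=> // r' r_lt; rewrite /s2 /= -sc //; do !case: eqP => //; lia.
have U2 : s2.1 rU = idx v by rewrite /s2 /= sC ROr -vc M_ord.
have E2 : s2.1 rI = oE by rewrite /s2 /= RE RZ addn0.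
have T2 : s2.1 rT = m by rewrite /s2 /= RM RZ addn0.
have sc2 : consts s2.1 by case: sim2.
apply: runs_seq; have := edge_loop sc2 M_inp M_mark U2 erefl E2 T2.
move=> /runs_frame/runs_weak; apply=> // s3 [ok3 keep /(_ isT) mem3].
have sim3 : simulates (AState F c b None) s3.
  have [_ run2 res2 /(_ erefl) [[? ? ? ? ?] ? ?]] := sim2.
  split; rewrite ?mem3 ?keep //; first by move=> r' r_lt; rewrite keep ?sc2 //;
    case: r' r_lt; do 11?case.
have U3 : s3.1 rU = idx v by rewrite keep.
have [vF|vF] := boolP (free F v).
  by apply: runs_if; rewrite ok3 vF; apply: push_simulates sim3 U3.
apply: runs_if; rewrite ok3 (negPf vF) /=; apply: runs_blk => //.
have pickv : [pick u | pos u == c] = Some v by rewrite -vc pick_inj //; apply: pos_inj.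
rewrite cb pickv (negPf vF);
  have [sc3 run3 res3 /(_ erefl) [[C3 B3 W3 Sp3 J3] ok' [? ? ? ?]]] := sim3.
have RO := sc3 5 isT; rewrite /= in RO.
split=> //=.
  by move=> r' r_lt; rewrite /= -sc3 //; case: eqP => //; lia.
move=> _; split=> //; first by rewrite C3 RO addn1.
split=> // [|sF]; first exact: wf_frames_le ok.
by rewrite (leq_trans (full sF)).
Qed.

(** * The whole program *)

Definition solver_time t : nat :=
  15 + ((n * (5 + ((n * 22).+1 + 4)).+2).+1 +
    (5 + (t * (1 + (5 + ((m * 32).+1 + 32)).+2).+2).+1)).

Lemma solver_runs t (ans : bool) :
  answer (iter t step (AState [::] 0 n None)) = Some ans ->
  runs solver ((fun => 0), inp) (solver_time t) (fun s => s.1 rRes = ans).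
Proof.
set a0 := AState _ _ _ _ => ans_t.
(* The main loop stops at the first answer, so it makes exactly [t0] rounds; answered states are
   fixed by the machine, so the state after [t] steps is the same. *)
have [t0 t0_ans t0_min] : exists2 t0, answer (iter t0 step a0) != None &
    forall i, i < t0 -> answer (iter i step a0) = None.
  have ex : exists i, answer (iter i step a0) != None by exists t; rewrite ans_t.
  exists (ex_minn ex); case: ex_minnP => // t0 _ min i; rewrite ltnNge.
  by case E: (answer _) => // /negP; case; apply: min; rewrite E.
have t0t : t0 <= t by rewrite leqNgt; apply/negP => /t0_min; rewrite ans_t.
have t0E : iter t step a0 = iter t0 step a0 by rewrite -(subnK t0t) iterD iter_answer.
apply: runs_seq; apply: runs_blk => //; apply: runs_seq.
apply: runs_weak (sort_runs setup_inv) _ _ => // s [sc [[sV sT sJ sR] [M_inp M_ord M_0]]].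
apply: runs_seq; apply: runs_blk => //; set s1 := foldl _ _ _.
have sim0 : simulates (iter 0 step a0) s1.
  split=> //; first by move=> r r_lt; rewrite /s1 /= -sc //; do !case: eqP => //; lia.
  move=> _; have [RZ RN RStk] := And3 (sc 1 isT) (sc 2 isT) (sc 11 isT).
  rewrite /= in RZ RN RStk; rewrite /s1; split; split=> //=.
  - by rewrite RN RZ addn0.
  - by rewrite /total big_nil.
  - by rewrite RStk RZ.
  - by rewrite sJ addn0.
  (* Since [k] is positive, the empty stack is not full. *)
  - by move=> k0; move: (k_gt0); rewrite -k0.
  - by move=> v; apply: M_ord; apply: idx_lt.
  - by move=> v; rewrite M_0 // leq_addr.
have main : runs (While rRun search_step) s1
    (t0 * (1 + (5 + ((m * 32).+1 + 32)).+2).+2).+1 (simulates (iter t0 step a0)).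
  apply: (runs_while (Inv := fun i => simulates (iter i step a0))) => // i s'.
    rewrite leq_eqVlt => /predU1P[-> | lt].
      by rewrite ltnn; case: (iter t0 _ _) t0_ans => ? ? ? [] // ? _ [_ ->].
    by rewrite lt; have := t0_min _ lt; case: (iter i _ _) => ? ? ? ? /= -> [_ ->].
  by move=> lt; apply: search_step_simulates; apply: t0_min.
apply: runs_weak main _ _ => [|s'].
  by rewrite ltnS leq_mul2r t0t orbT.
rewrite -t0E; case: (iter t _ _) ans_t => ? ? ? ? /= -> [_ _ -> _].
by case: ans.
Qed.

Lemma solver_correct h :
  (forall (A : {set G}) j, h <= #|A| -> j <= k ->
    exists I : {set G}, [/\ I \subset A, independent I & #|I| = j]) ->
  0 < rho -> 0 < h -> [|| 1 < h, k == 1 | n == 0] ->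
  exists2 t, t <= 2 * (n + 2) * h ^ k &
    runs solver ((fun => 0), inp) (solver_time t) (fun s => s.1 rRes = sbmwis k rho w).
Proof.
move=> ind rho_gt0 h_gt0 hyp.
have [t tN] := search_answer pos_lt pos_inj pos_onto pos_w ind rho_gt0 h_gt0 hyp.
by rewrite (gtn_eqF k_gt0) => ans; exists t => //; apply: solver_runs.
Qed.

End Simulation.

(** * From the graph class to the time bound *)

Lemma ifc_indep f (C : sgraph -> Prop) (f_mono : {homo f : x y / x <= y})
    (f_unb : forall k, exists n, k <= f n) (G : sgraph) k :
  ifc f C -> C G -> forall (A : {set G}) j, geninv f_unb k <= #|A| -> j <= k ->
  exists I : {set G}, [/\ I \subset A, independent I & #|I| = j].
Proof.
move=> [hered ind] CG A j hA jk; have [S [indS Sf]] := ind _ (hered G A CG).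
have kS : j <= #|val @: S|.
  rewrite card_imset; last exact: val_inj.
  apply: leq_trans jk _; rewrite Sf card_sig; move: hA.
  rewrite /geninv; case: ex_minnP => h kh _ /f_mono; apply: leq_trans.
  exact: kh.
have valS : forall x, x \in val @: S -> exists2 y, y \in S & x = val y.
  by move=> x /imsetP[y yS ->]; exists y.
have indV : independent (val @: S).
  apply/independentP => x y /valS[u uS ->] /valS[v vS ->].
  by have /independentP := indS; apply.
exists [set x in take j (enum (val @: S))];
  have sub : [set x in take j (enum (val @: S))] \subset val @: S.
  by apply/subsetP => x; rewrite inE => /mem_take; rewrite mem_enum.
split.
- by apply: subset_trans sub _; apply/subsetP => x /valS[y _ ->]; apply: valP.
- exact: independentS indV.
- rewrite cardsE (card_uniqP _) ?take_uniq ?enum_uniq // size_take -cardE.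
  by case: ltngtP kS.
Qed.

(** An induced subgraph on [i] vertices is in the class, and its independent set of size [f i] has
    to fit into it. *)
Lemma ifc_le f (C : sgraph -> Prop) (G : sgraph) i :
  ifc f C -> C G -> i <= #|G| -> f i <= i.
Proof.
move=> [hered ind] CG iG.
pose A := [set x in take i (enum G)].
have cA : #|A| = i.
  rewrite cardsE (card_uniqP _) ?take_uniq ?enum_uniq // size_take -cardE.
  by case: ltngtP iG.
have [S [_ SE]] := ind _ (hered G A CG).
have := max_card (mem S); rewrite SE card_sig cA.
exact.
Qed.

(** With [s = maxn 1 (N + M)], sorting takes about [40 * s ^ 2] and the search at most [6 * s * E]
    rounds of cost [80 * s]; the rest of 600 absorbs the additive constants. *)
Lemma solver_time_le (N M E t : nat) : 0 < E -> t <= 2 * (N + 2) * E ->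
  15 + ((N * (5 + ((N * 22).+1 + 4)).+2).+1 +
    (5 + (t * (1 + (5 + ((M * 32).+1 + 32)).+2).+2).+1)) <=
  600 * (E * maxn 1 (N + M) ^ 2).
Proof.
move=> E0 tE; set s := maxn 1 (N + M).
have [s1 Ns Ms] : [/\ 0 < s, N <= s & M <= s] by rewrite /s; split; lia.
have tS : t <= 6 * s * E by apply: leq_trans tE _; rewrite leq_mul2r; apply/orP; right;
  lia.
have step_le : (1 + (5 + ((M * 32).+1 + 32)).+2).+2 <= 80 * s by lia.
have sort_le : N * (5 + ((N * 22).+1 + 4)).+2 <= s * (40 * s) by apply: leq_mul => //;
  lia.
have main_le := leq_mul tS step_le.
have s2 : 0 < s * s by rewrite muln_gt0 s1.
have sE : s * s <= E * (s * s) by rewrite leq_pmull.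
rewrite -mulnn; move: sort_le main_le.
have -> : s * (40 * s) = 40 * (s * s) by lia.
have -> : 6 * s * E * (80 * s) = 480 * (E * (s * s)) by lia.
move: (N * _) (t * _) (E * (s * s)) (s * s) sE s2 => a b c d; lia.
Qed.

(* [maxn 1 (n + m)] is n + m except for the graph without vertices, where a
   literal (n + m) ^ c would be 0. *)
Theorem theorem2 :
  forall (f : nat -> nat)
    (f_mono : {homo f : x y / x <= y})
    (f_unb : forall k, exists n, k <= f n)
    (C : sgraph -> Prop),
  ifc f C ->
  exists (P : program) (a c : nat),
    forall (G : sgraph) (k rho : nat) (w : G -> nat) (x : seq nat),
      C G -> 0 < k -> 0 < rho -> encodes k rho w x ->
      exists t : nat,
        t <= a * (geninv f_unb k ^ k * maxn 1 (#|G| + #|edges G|) ^ c) /\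
        outputs P x t (nat_of_bool (sbmwis k rho w)).
Proof.
move=> f f_mono f_unb C fC; exists (code 0 solver), 600, 2.
move=> G k rho w x CG k0 rho0 [vs [es [vsE esE ->]]].
rewrite -/(input w k rho vs es).
set h := geninv f_unb k.
have kh : k <= f h by rewrite /h /geninv; case: ex_minnP.
(* Here [f 0 = 0], whereas [f h] is at least [k > 0]; so [h] is positive. *)
have f0 := ifc_le fC CG (leq0n _).
have h0 : 0 < h by rewrite lt0n; apply/eqP => E; move: kh; rewrite E; lia.
(* If [h = 1] and there is a vertex, then [k <= f 1 <= 1]. *)
have hyp : [|| 1 < h, k == 1 | #|G| == 0].
  have [//|h1] := ltnP 1 h; have [n0|n0] := posnP #|G|.
    by apply/or3P/Or33/eqP.
  have E : h = 1 by lia.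
  by have := ifc_le fC CG n0; rewrite E in kh *; lia.
have ind := @ifc_indep f C f_mono f_unb G k fC CG.
have [t tN [t' [s' [t'T run_s res]]]] := solver_correct w vsE esE k0 ind rho0 h0 hyp.
exists t'; split.
  apply: leq_trans t'T _; apply: solver_time_le => //.
  by rewrite expn_gt0 h0.
have := run_code run_s isT isT erefl (pre := [::]) (post := [::]) (erefl _).
rewrite /outputs cats0 /= => ->; split=> //.
Qed.
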